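(* Let $\mathbb{F}=\mathbb{R}$ or $\mathbb{C}$, and set $\alpha=1$ if $\mathbb{F}=\mathbb{R}$ and $\alpha=2$ if $\mathbb{F}=\mathbb{C}$. Let $n\ge1$, let $\mathcal{S}\subseteq\mathcal{S}'\subseteq\mathbb{F}^n$ be linear subspaces, let $p=\dim(\mathcal{S})$ and $q=\dim(\mathcal{S}')-\dim(\mathcal{S})$, and assume $q\le p$. Then $$\mathcal{M}(\mathcal{S},\mathcal{S}'):=\{A\in\mathbb{F}^{n\times n}:\mathcal{S}+A\mathcal{S}=\mathcal{S}'\}$$ is a smooth embedded submanifold of $\mathbb{R}^{\alpha n^2}$ (identified with $\mathbb{F}^{n\times n}$) of dimension $\alpha\,(n^2-p(n-p-q))$.
   Context: $A\mathcal{S}=\{Ax:x\in\mathcal{S}\}$. $\mathbb{R}^{n\times n}$ and $\mathbb{C}^{n\times n}$ are identified with the smooth real manifolds $\mathbb{R}^{n^2}$ and $\mathbb{R}^{2n^2}$ respectively, and $\mathcal{M}(\mathcal{S},\mathcal{S}')$ carries the subset topology. ''Manifold'' and ''dimension'' refer to real smooth manifolds. *)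

(* Defs.v *)
From HB Require Import structures.
From mathcomp Require Import all_boot all_order all_algebra.
From mathcomp Require Import complex.
From mathcomp Require Import all_classical all_reals all_analysis.

Set Implicit Arguments.
Unset Strict Implicit.
Unset Printing Implicit Defensive.

Import Order.TTheory GRing.Theory Num.Theory.
Import numFieldNormedType.Exports.

Local Open Scope classical_set_scope.
Local Open Scope ring_scope.

Section EmbeddedSubmanifold.
Context {R : realType}.

(* C^k on an open set [U].  In finite dimension, [f] is C^(k+1) on [U] iff it
   is (Frechet) differentiable there and all of its directional derivatives
   are C^k. *)
Fixpoint C_k_on (k : nat) (m n : nat) (U : set 'rV[R]_m)
    (f : 'rV[R]_m -> 'rV[R]_n) : Prop :=
  match k with
  | 0 => forall x, U x -> {for x, continuous f}
  | k'.+1 => (forall x, U x -> differentiable f x) /\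
             (forall v, C_k_on k' U (fun x => 'D_v f x))
  end.

Definition smooth_on (m n : nat) (U : set 'rV[R]_m)
    (f : 'rV[R]_m -> 'rV[R]_n) : Prop := forall k, C_k_on k U f.

(* [f] restricts to a smooth diffeomorphism from the open set [U] onto the
   open set [V], with inverse [g]; the values of [f] outside [U] and of [g]
   outside [V] are irrelevant. *)
Definition diffeomorphism (m n : nat) (U : set 'rV[R]_m) (V : set 'rV[R]_n)
    (f : 'rV[R]_m -> 'rV[R]_n) (g : 'rV[R]_n -> 'rV[R]_m) : Prop :=
  [/\ open U /\ open V,
      smooth_on U f /\ smooth_on V g,
      (forall x, U x -> V (f x)) /\ (forall y, V y -> U (g y)),
      (forall x, U x -> g (f x) = x) &
      (forall y, V y -> f (g y) = y)].

(* R^d x {0} inside R^N, for d <= N. *)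
Definition coordinate_slice (N d : nat) : set 'rV[R]_N :=
  [set y | forall j : 'I_N, (d <= j)%N -> y ord0 j = 0].
Arguments coordinate_slice : clear implicits.

(* Around each of its points, [M] is straightened onto R^d x {0} by a smooth
   chart of R^N; the restrictions of these charts to [M] form a smooth atlas
   of dimension [d] for the subset topology. *)
Definition embedded_submanifold (N d : nat) (M : set 'rV[R]_N) : Prop :=
  (d <= N)%N /\
  forall x, M x ->
    exists (U V : set 'rV[R]_N) (f g : 'rV[R]_N -> 'rV[R]_N),
      [/\ U x, diffeomorphism U V f g &
          f @` (M `&` U) = V `&` coordinate_slice N d].

End EmbeddedSubmanifold.

Variant scalars := RealScalars | ComplexScalars.

Definition scalar_field (R : realType) (k : scalars) : fieldType :=
  match k with RealScalars => R | ComplexScalars => R[i] end.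

Definition alpha (k : scalars) : nat :=
  match k with RealScalars => 1 | ComplexScalars => 2 end.

Definition real_coords (R : realType) (k : scalars) :
    scalar_field R k -> 'cV[R]_(alpha k) :=
  match k return scalar_field R k -> 'cV[R]_(alpha k) with
  | RealScalars => fun z : R => \col_(i < 1) z
  | ComplexScalars => fun z : R[i] =>
      \col_(i < 2) (if i == ord0 then complex.Re z else complex.Im z)
  end.

(* The identification of F^(n x n) with R^(alpha n^2): the real coordinates of
   all entries, as a row vector (for F = C, the real parts come first). *)
Definition to_real_space (R : realType) (k : scalars) (n : nat)
    (A : 'M[scalar_field R k]_n) : 'rV[R]_(alpha k * n ^ 2) :=
  mxvec (\matrix_(i < alpha k, j < n * n) real_coords (mxvec A ord0 j) i ord0).

Definition calM (F : fieldType) (n : nat) (S S' : {vspace 'cV[F]_n}) :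
    set 'M[F]_n :=
  [set A | (S + linfun (mulmx A) @: S)%VS = S'].

(* Main.v *)
(* [S + A S = S'] says that [A S] lies in [S'], which is a linear condition on
   [A], and that [A] induces a surjection from [S] onto [S' / S], which is an
   open condition. Hence the set is a relatively open subset of the linear
   subspace [{A | A S <= S'}], the kernel of a surjective linear map onto the
   [(n - dim S') x dim S] matrices, and linear charts straighten it. *)
Require Import Defs.
From HB Require Import structures.
From mathcomp Require Import all_boot all_order all_algebra complex ring.
From mathcomp Require Import all_classical all_reals all_analysis.

Set Implicit Arguments.
Unset Strict Implicit.
Unset Printing Implicit Defensive.

Import Order.TTheory GRing.Theory Num.Theory numFieldNormedType.Exports.
Local Open Scope classical_set_scope.
Local Open Scope ring_scope.

(** * Linear charts, and submanifolds that are relatively open in a row space *)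

Lemma continuous_mulmxr (R : realType) (m n : nat) (G : 'M[R]_(m, n)) :
  continuous (mulmxr G : 'rV[R]_m -> 'rV[R]_n).
Proof.
move=> x.
have -> : (mulmxr G : 'rV[R]_m -> 'rV[R]_n) =
    fun x : 'rV[R]_m => \sum_(i <- index_enum 'I_m) x ord0 i *: row i G.
  by apply/funext => y /=; rewrite mulmx_sum_row.
apply: (continuous_big (P := xpredT) add_continuous) => i _ y.
exact: cvgZr_tmp (@coord_continuous R 1 m ord0 i y).
Qed.

Lemma C_k_on_cst (R : realType) (k m n : nat) (U : set 'rV[R]_m)
    (c : 'rV[R]_n) : C_k_on k U (cst c).
Proof.
elim: k c => [|k IH] c /=; first by move=> x _; exact: cst_continuous.
split=> [x _|v]; first exact: differentiable_cst.
rewrite (_ : (fun x => _) = cst 0); first exact: IH.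
by apply/funext => x; rewrite derive_cst.
Qed.

(** Each directional derivative of a linear map is constant, so the higher orders only concern
    constant maps. *)
Lemma smooth_on_mulmxr (R : realType) (m n : nat) (U : set 'rV[R]_m)
    (G : 'M[R]_(m, n)) : smooth_on U (mulmxr G).
Proof.
have Gd x : differentiable (mulmxr G : 'rV[R]_m -> 'rV[R]_n) x.
  by apply: linear_differentiable; exact: continuous_mulmxr.
case=> [|k] /=; first by move=> x _; exact: continuous_mulmxr.
split=> // v.
rewrite (_ : (fun x => _) = cst (v *m G)); first exact: C_k_on_cst.
apply/funext => x; rewrite deriveE // diff_lin //; exact: continuous_mulmxr.
Qed.

Lemma coordinate_slice_pid_mx (R : realType) (N d : nat) (z : 'rV[R]_N) :
  (d <= N)%N ->
  @coordinate_slice R N d z <-> (z <= (pid_mx d : 'M[R]_(d, N)))%MS.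
Proof.
move=> dN; split=> [zS|/submxP[w ->] j dj].
  (* The witness consists of the first [d] coordinates of [z]; padding it with zeros gives back [z],
     as the others vanish on the slice. *)
  apply/submxP; exists (z *m pid_mx d).
  rewrite -mulmxA pid_mx_id //; apply/rowP => j; rewrite !mxE (bigD1 j) //=.
  rewrite big1 ?addr0 => [|i /negPf ij]; last by rewrite !mxE val_eqE ij mulr0.
  rewrite !mxE eqxx /=; case: ltnP => [_|dj]; first by rewrite mulr1.
  by rewrite zS ?mul0r.
rewrite mxE big1 // => i _; rewrite !mxE.
case: eqP => [ij|]; last by rewrite mulr0.
by have := ltn_ord i; rewrite ij ltnNge dj.
Qed.

(** The rank normal form of [H] is an invertible matrix times [pid_mx d] times [row_ebase H]. Right
    multiplication by the inverse of the last factor carries the row space of [H] onto the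
    coordinate slice, so a single linear map serves as chart at every point and only its domain [U]
    varies. *)
Lemma embedded_submanifold_rowspace (R : realType) (d N : nat)
    (H : 'M[R]_(d, N)) (M : set 'rV[R]_N) :
  row_free H ->
  (forall x, M x -> (x <= H)%MS) ->
  (forall x, M x -> exists U : set 'rV[R]_N,
     [/\ open U, U x & forall y, U y -> (y <= H)%MS -> M y]) ->
  embedded_submanifold d M.
Proof.
move=> Hfree MH Mopen.
have rH : \rank H = d by apply/eqP.
split; first by rewrite -rH rank_leq_col.
move=> x Mx; have [U [oU Ux UM]] := Mopen _ Mx.
set E := row_ebase H; have Eu : E \in unitmx by exact: row_ebase_unit.
have sliceE (y : 'rV[R]_N) :
    @coordinate_slice R N d (y *m invmx E) <-> (y <= H)%MS.
  rewrite coordinate_slice_pid_mx; last by rewrite -rH rank_leq_col.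
  suff -> : (y <= H)%MS = (y *m invmx E <= (pid_mx d : 'M[R]_(d, N)))%MS by [].
  (* The invertible left factor of the normal form leaves the row space unchanged, and the right
     factor [E] cancels on both sides. *)
  have full : row_full (col_ebase H) by rewrite row_full_unit col_ebase_unit.
  rewrite -{1}[H]mulmx_ebase -/E rH -{1}[y](mulmxKV Eu).
  by rewrite submxMfree ?row_free_unit // (eqmxMfull _ full).
exists U, (mulmxr E @^-1` U), (mulmxr (invmx E)), (mulmxr E); split => //.
- split=> /=.
  + by split=> //; apply: open_comp => // y _; exact: continuous_mulmxr.
  + by split; exact: smooth_on_mulmxr.
  + by split=> // y Uy; rewrite mulmxKV.
  + by move=> y _; rewrite mulmxKV.
  + by move=> y _; rewrite mulmxK.
- apply/seteqP; split=> [_ [y [My Uy] <-]|y [/= VY Sy]] /=.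
    by split; [rewrite /= mulmxKV|apply/sliceE/MH].
  exists (y *m E); last by rewrite mulmxK.
  by split=> //; apply: UM => //; apply/sliceE; rewrite mulmxK.
Qed.

(** * Matrix equations for the condition S + A S = T over a field *)

Section ColumnSpaces.
Variables (F : fieldType) (n : nat).
Implicit Types S T : {vspace 'cV[F]_n}.

Definition basis_mx S : 'M[F]_(n, \dim S) :=
  \matrix_(i, j) (vbasis S)`_j i ord0.

Lemma mul_basis_mx S (u : 'cV[F]_(\dim S)) :
  basis_mx S *m u = \sum_j u j ord0 *: (vbasis S)`_j.
Proof.
apply/colP => i; rewrite mxE summxE.
by apply: eq_bigr => j _; rewrite !mxE mulrC.
Qed.

Lemma mem_basis_mx S v :
  reflect (exists u, v = basis_mx S *m u) (v \in S).
Proof.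
apply: (iffP idP) => [vS|[u ->]].
  exists (\col_j coord (vbasis S) j v).
  rewrite mul_basis_mx {1}(coord_vbasis vS).
  by apply: eq_bigr => j _; rewrite mxE.
rewrite mul_basis_mx; apply: memv_suml => j _.
by apply/memvZ/vbasis_mem/mem_nth; rewrite size_tuple.
Qed.

Lemma basis_mx_linv S : exists D : 'M[F]_(\dim S, n), D *m basis_mx S = 1%:M.
Proof.
have /row_freeP[D DP] : row_free (basis_mx S)^T.
  apply: inj_row_free => v /(congr1 trmx).
  rewrite trmx_mul trmxK trmx0 mul_basis_mx => v0.
  apply/rowP => j; rewrite mxE.
  have fS : free (vbasis S) by apply: (basis_free (vbasisP S)).
  have := coord_sum_free (fun j => v^T j ord0) j fS.
  by rewrite v0 linear0 mxE.
by exists D^T; apply: trmx_inj; rewrite trmx_mul trmxK DP trmx1.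
Qed.

Lemma mxrank_basis_mx S : \rank (basis_mx S) = \dim S.
Proof.
have [D DP] := basis_mx_linv S.
apply/eqP; rewrite eqn_leq rank_leq_col /=.
by rewrite -{1}(mxrank1 F (\dim S)) -DP mxrankM_maxr.
Qed.

Lemma basis_mx_factor S k (X : 'M[F]_(n, k)) :
  (forall u : 'cV_k, X *m u \in S) -> exists Z, X = basis_mx S *m Z.
Proof.
move=> XS; have Xc j : exists z, col j X = basis_mx S *m z.
  by apply/mem_basis_mx; rewrite colE.
have [z zP] := fin_all_exists Xc.
exists (\matrix_(i, j) z j i ord0); apply/matrixP => i j.
have /colP/(_ i) := zP j; rewrite !mxE => ->.
by apply: eq_bigr => l _; rewrite !mxE.
Qed.

(** The first condition encodes that A S lies in T, and the second that T lies in S + A S. This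
    separates the linear constraint on [A] from the one that will turn out to be open. *)
Lemma calM_basis_mxP S T (A : 'M[F]_n) : (S <= T)%VS ->
  calM S T A <->
  (exists Z, A *m basis_mx S = basis_mx T *m Z) /\
  (exists X Y, basis_mx T = basis_mx S *m X + A *m basis_mx S *m Y).
Proof.
move=> ST; split=> [AM|[[Z AZ] [X [Y TE]]]].
  rewrite /calM /= in AM.
  have AS v : v \in S -> A *m v \in T.
    move=> vS; rewrite -AM -[_ *m _]add0r memv_add ?mem0v //.
    by rewrite -[A *m v](lfunE (mulmx A)) memv_img.
  split.
    apply: basis_mx_factor => u; rewrite -mulmxA AS //.
    by apply/mem_basis_mx; exists u.
  (* Each basis vector of T splits along S + A S; the coordinates of the two summands become the
     columns of [X] and [Y]. *)
  have Tc j : exists z : 'cV_(\dim S) * 'cV_(\dim S),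
      col j (basis_mx T) = basis_mx S *m z.1 + A *m basis_mx S *m z.2.
    have : col j (basis_mx T) \in (S + linfun (mulmx A) @: S)%VS.
      by rewrite AM; apply/mem_basis_mx; exists (delta_mx j ord0); rewrite colE.
    case/memv_addP => _ /mem_basis_mx[x ->].
    case=> _ /memv_imgP[_ /mem_basis_mx[y ->] ->] ->.
    by exists (x, y); rewrite lfunE /= mulmxA.
  have [z zP] := fin_all_exists Tc.
  exists (\matrix_(i, j) (z j).1 i ord0), (\matrix_(i, j) (z j).2 i ord0).
  apply/matrixP => i j; have /colP/(_ i) := zP j; rewrite !mxE => ->.
  by congr (_ + _); apply: eq_bigr => l _; rewrite !mxE.
rewrite /calM /=; apply/eqP; rewrite eqEsubv subv_add ST /=; apply/andP; split.
  apply/subvP => _ /memv_imgP[v /mem_basis_mx[u ->] ->].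
  by apply/mem_basis_mx; exists (Z *m u); rewrite lfunE /= !mulmxA AZ.
apply/subvP => _ /mem_basis_mx[u ->]; rewrite TE mulmxDl memv_add //.
  by rewrite -mulmxA; apply/mem_basis_mx; exists (X *m u).
rewrite -!mulmxA -[A *m _](lfunE (mulmx A)) memv_img //.
by apply/mem_basis_mx; exists (Y *m u).
Qed.

(* The determinant is that of [P (B X + A B Y)], where [B] and [B'] are the
   basis matrices of [S] and [T], [B' = B X + A0 B Y] and [P] is a left inverse
   of [B']. *)
Lemma calM_locally_linear S T (A0 : 'M[F]_n) : (S <= T)%VS -> calM S T A0 ->
  exists r (C0 : 'M[F]_r) (C1 : 'M[F]_(r, n)) (C2 : 'M[F]_(n, r)),
    \det (C0 + C1 *m A0 *m C2) != 0 /\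
    forall A, (exists Z, A *m basis_mx S = basis_mx T *m Z) ->
      \det (C0 + C1 *m A *m C2) != 0 -> calM S T A.
Proof.
move=> ST /(calM_basis_mxP _ ST)[_ [X [Y TE]]].
have [P PT] := basis_mx_linv T.
have [W WE] : exists W, basis_mx S = basis_mx T *m W.
  apply: basis_mx_factor => u; apply: (subvP ST).
  by apply/mem_basis_mx; exists u.
exists _, (P *m (basis_mx S *m X)), P, (basis_mx S *m Y).
have E A : P *m (basis_mx S *m X) + P *m A *m (basis_mx S *m Y) =
    P *m (basis_mx S *m X + A *m basis_mx S *m Y).
  by rewrite mulmxDr !mulmxA.
split=> [|A [Z AZ]]; first by rewrite E -TE PT det1 oner_neq0.
rewrite E => detN0; apply/calM_basis_mxP => //; split; first by exists Z.
set G := P *m _ in detN0; have Gu : G \in unitmx by rewrite unitmxE unitfE.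
(* Once B X + A B Y = B' G is known, with B and B' the basis matrices of S and T, dividing by [G] on
   the right writes B' in the required form. *)
exists (X *m invmx G), (Y *m invmx G).
rewrite !mulmxA -mulmxDl.
(* Both summands factor through B', through [W] and [Z] respectively, and B' P is the identity on
   such matrices. *)
have -> : basis_mx S *m X + A *m basis_mx S *m Y = basis_mx T *m G.
  rewrite /G AZ WE -!mulmxA -mulmxDr.
  by rewrite [P *m _]mulmxA PT mul1mx.
by rewrite mulmxK.
Qed.

Lemma mulmx_annihilator k (X : 'M[F]_(n, k)) :
  exists C : 'M[F]_(n - \rank X, n), row_free C /\
    forall l (V : 'M[F]_(n, l)), (exists Z, V = X *m Z) <-> C *m V = 0.
Proof.
(* The number of rows is first left free, because the rank of the cokernel matrix equals n - rank X
   only up to a proof. The same device recurs for the kernel in [mx_preserving_rowspace]. *)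
suff [m [->]] : exists m, m = (n - \rank X)%N /\
    exists C : 'M[F]_(m, n), row_free C /\
    forall l (V : 'M[F]_(n, l)), (exists Z, V = X *m Z) <-> C *m V = 0 by [].
eexists; split; last exists (col_base (cokermx X^T))^T; last split.
- by rewrite mxrank_coker mxrank_tr.
- by rewrite /row_free mxrank_tr; exact: col_base_full.
move=> l V; have -> : (exists Z, V = X *m Z) <-> (V^T <= X^T)%MS.
  split=> [[Z ->]|/submxP[Z /(congr1 trmx)]]; first by rewrite trmx_mul submxMl.
  by rewrite trmx_mul !trmxK => ->; exists Z^T.
rewrite submxE -{1}[cokermx _]mulmx_base mulmxA.
rewrite mulmx_free_eq0 ?row_base_free //.
split=> [/eqP/(congr1 trmx)|CV].
  by rewrite trmx_mul trmxK trmx0.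
by apply/eqP/trmx_inj; rewrite trmx_mul trmxK trmx0.
Qed.

Lemma mx_preserving_rowspace S T :
  exists L : 'M[F]_(n * n - (n - \dim T) * \dim S, n * n), row_free L /\
    forall A : 'M[F]_n, (mxvec A <= L)%MS <->
      exists Z, A *m basis_mx S = basis_mx T *m Z.
Proof.
have := mulmx_annihilator (basis_mx T); rewrite mxrank_basis_mx.
set m := (n - _)%N => -[C [/row_freeP[C' CC'] CP]].
have [D DS] := basis_mx_linv S.
pose K := lin_mulmx C *m lin_mulmxr (basis_mx S).
have KE (A : 'M[F]_n) : mxvec A *m K = mxvec (C *m A *m basis_mx S).
  by rewrite mulmxA !mul_vec_lin /=.
have rK : \rank K = (m * \dim S)%N.
  apply/eqP; rewrite -/(row_full K); rewrite -sub1mx.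
  apply/row_subP => i; rewrite -[row i _]vec_mxK.
  (* A right inverse [C'] of [C] and a left inverse [D] of B make C' Z D a preimage of [Z]. *)
  set Z := vec_mx _; apply/submxP; exists (mxvec (C' *m Z *m D)).
  by rewrite KE !mulmxA CC' mul1mx -mulmxA DS mulmx1.
suff [d [->]] : exists d, d = (n * n - m * \dim S)%N /\
    exists L : 'M[F]_(d, n * n), row_free L /\
    forall A : 'M[F]_n, (mxvec A <= L)%MS <->
      exists Z, A *m basis_mx S = basis_mx T *m Z by [].
eexists; split; last exists (row_base (kermx K)); last split.
- by rewrite mxrank_ker rK.
- exact: row_base_free.
move=> A; rewrite eq_row_base CP; split=> [/sub_kermxP|AC].
  by rewrite KE mulmxA -[RHS](linear0 mxvec) => /(can_inj mxvecK).
by apply/sub_kermxP; rewrite KE -mulmxA AC linear0.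
Qed.

End ColumnSpaces.

(** * Passage from F to real coordinates *)

Section RealCoordinates.
Variables (R : realType) (k : scalars).
Local Notation F := (scalar_field R k).
Local Notation a := (alpha k).

Definition of_real_coords : 'cV[R]_a -> F :=
  match k return 'cV[R]_(alpha k) -> scalar_field R k with
  | RealScalars => fun c : 'cV[R]_1 => c ord0 ord0
  | ComplexScalars => fun c : 'cV[R]_2 => (c ord0 ord0 +i* c ord_max ord0)%C
  end.

Lemma real_coordsK : cancel (@real_coords R k) of_real_coords.
Proof. by rewrite /of_real_coords; case: k => [z|[x y]] /=; rewrite !mxE. Qed.

Lemma of_real_coordsK : cancel of_real_coords (@real_coords R k).
Proof.
rewrite /of_real_coords; case: k => c /=; apply/colP => i; rewrite mxE.
  by rewrite (ord1 i).
by case: i => [[|[|//]] /= lti]; congr (c _ _); apply/val_inj.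
Qed.

Lemma real_coordsD : {morph @real_coords R k : x y / x + y}.
Proof.
case: k => [x y|[x x'] [y y']]; apply/colP => i; rewrite !mxE //=.
by case: ifP.
Qed.

Lemma real_coords0 : @real_coords R k 0 = 0.
Proof. by apply: (addIr (real_coords 0)); rewrite -real_coordsD !add0r. Qed.

Lemma real_coords_sum I (r : seq I) (f : I -> F) :
  real_coords (\sum_(i <- r) f i) = \sum_(i <- r) real_coords (f i).
Proof. exact: (big_morph _ real_coordsD real_coords0). Qed.

Lemma real_coords_mul_linear (z : F) :
  linear (fun c => real_coords (of_real_coords c * z)).
Proof.
rewrite /of_real_coords; case: k z => [z|[z z']] t c d;
  apply/colP => i; rewrite !mxE /=.
  by rewrite mulrDl mulrA.
by case: ifP => _; ring.
Qed.

(** This is the array of real coordinates before flattening: [to_real_space A] unfolds to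
    [mxvec (realify (mxvec A))]. *)
Definition realify l (v : 'rV[F]_l) : 'M[R]_(a, l) :=
  \matrix_(i, j) real_coords (v ord0 j) i ord0.

Definition unrealify l (W : 'M[R]_(a, l)) : 'rV[F]_l :=
  \row_j of_real_coords (col j W).

Lemma realifyK l : cancel (@realify l) (@unrealify l).
Proof.
move=> v; apply/rowP => j; rewrite mxE -[RHS]real_coordsK; congr of_real_coords.
by apply/colP => i; rewrite !mxE.
Qed.

Lemma unrealifyK l : cancel (@unrealify l) (@realify l).
Proof. by move=> W; apply/matrixP => i j; rewrite !mxE of_real_coordsK mxE. Qed.

Section RealRowSpace.
Variables (d l : nat) (L : 'M[F]_(d, l)).

(** This is right multiplication by [L] transported to real coordinates. Its matrix turns a row
    space over F spanned by [d] rows into a real one spanned by [alpha k * d] rows, whence the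
    factor [alpha k] in the dimension. *)
Definition realify_mul (w : 'rV[R]_(a * d)) : 'rV[R]_(a * l) :=
  mxvec (realify (unrealify (vec_mx w) *m L)).

Lemma realify_mul_is_linear : linear realify_mul.
Proof.
move=> t w w'; rewrite /realify_mul -linearP; congr mxvec.
apply/matrixP => i j; rewrite !mxE !real_coords_sum !summxE mulr_sumr -big_split.
apply: eq_bigr => s _ /=; rewrite !mxE linearP /= linearP.
by rewrite real_coords_mul_linear !mxE.
Qed.

HB.instance Definition _ := GRing.isLinear.Build R _ _ _ realify_mul
  realify_mul_is_linear.

Lemma mul_lin1_realify_mul w : w *m lin1_mx realify_mul = realify_mul w.
Proof. exact: mul_rV_lin1. Qed.

(** The map is a composite of injections: the coordinate bijections and multiplication by a row-free
    matrix. *)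
Lemma row_free_realify_mul : row_free L -> row_free (lin1_mx realify_mul).
Proof.
move=> Lfree; apply: inj_row_free => w; rewrite mul_lin1_realify_mul => w0.
apply: (can_inj vec_mxK); apply: (can_inj (@unrealifyK _)).
apply: (row_free_inj Lfree); apply: (can_inj (@realifyK _)).
apply: (can_inj mxvecK); rewrite -/(realify_mul w) w0.
by rewrite -[LHS](linear0 realify_mul).
Qed.

Lemma submx_realify_mul (v : 'rV[F]_l) :
  (mxvec (realify v) <= lin1_mx realify_mul)%MS <-> (v <= L)%MS.
Proof.
split=> [/submxP[w]|/submxP[u ->]].
  rewrite mul_lin1_realify_mul => /(can_inj mxvecK)/(can_inj (@realifyK _)) ->.
  exact: submxMl.
apply/submxP; exists (mxvec (realify u)).
by rewrite mul_lin1_realify_mul /realify_mul mxvecK realifyK.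
Qed.

End RealRowSpace.

Definition of_real_space n (x : 'rV[R]_(a * n ^ 2)) : 'M[F]_n :=
  vec_mx (unrealify (vec_mx x)).

Lemma of_real_spaceK n : cancel (@of_real_space n) (@to_real_space R k n).
Proof.
move=> x; rewrite /to_real_space /of_real_space vec_mxK.
by rewrite [X in mxvec X]unrealifyK vec_mxK.
Qed.

Lemma to_real_spaceK n : cancel (@to_real_space R k n) (@of_real_space n).
Proof. by move=> A; rewrite /of_real_space mxvecK realifyK mxvecK. Qed.

(** * Continuity of F-valued functions and openness of the nonvanishing locus *)

Section ScalarContinuity.
Variable T : topologicalType.
Implicit Types f g : T -> F.

(** Since [scalar_field R k] is declared only as a [fieldType], continuity is tested on real
    coordinates, uniformly in both cases. *)
Definition scalar_continuous f :=
  forall i, continuous (fun x => real_coords (f x) i ord0).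

Lemma scalar_continuous_cst (c : F) : scalar_continuous (fun=> c).
Proof. by move=> i; exact: cst_continuous. Qed.

Lemma scalar_continuousD f g : scalar_continuous f -> scalar_continuous g ->
  scalar_continuous (fun x => f x + g x).
Proof.
move=> fc gc i.
rewrite (_ : (fun x => _) =
    fun x => real_coords (f x) i ord0 + real_coords (g x) i ord0).
  by move=> x; apply: continuousD; [exact: fc|exact: gc].
by apply/funext => x; rewrite real_coordsD mxE.
Qed.

Lemma scalar_continuousM f g : scalar_continuous f -> scalar_continuous g ->
  scalar_continuous (fun x => f x * g x).
Proof.
rewrite /scalar_continuous; case: k f g => [|] f g fc gc i.
  rewrite (_ : (fun x => _) =
      fun x => real_coords (f x) i ord0 * real_coords (g x) i ord0).
    by move=> x; apply: continuousM; [exact: fc|exact: gc].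
  by apply/funext => x; rewrite !mxE.
have Rec (h : T -> R[i]) : (forall i, continuous
    (fun x => @real_coords R ComplexScalars (h x) i ord0)) ->
    continuous (fun x => complex.Re (h x)).
  move=> /(_ ord0) hc; rewrite (_ : (fun x => _) =
    fun x => @real_coords R ComplexScalars (h x) ord0 ord0) //.
  by apply/funext => x; rewrite mxE.
have Imc (h : T -> R[i]) : (forall i, continuous
    (fun x => @real_coords R ComplexScalars (h x) i ord0)) ->
    continuous (fun x => complex.Im (h x)).
  move=> /(_ ord_max) hc; rewrite (_ : (fun x => _) =
    fun x => @real_coords R ComplexScalars (h x) ord_max ord0) //.
  by apply/funext => x; rewrite mxE.
(* The real and imaginary parts of a complex product are polynomials in those of the factors. *)
rewrite (_ : (fun x => _) = fun x => if i == ord0 then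
  complex.Re (f x) * complex.Re (g x) - complex.Im (f x) * complex.Im (g x) else
  complex.Re (f x) * complex.Im (g x) + complex.Im (f x) * complex.Re (g x)).
  have [[fR fI] [gR gI]] := ((Rec _ fc, Imc _ fc), (Rec _ gc, Imc _ gc)).
  case: (i == ord0) => /= x.
    exact: continuousB (continuousM (fR x) (gR x)) (continuousM (fI x) (gI x)).
  exact: continuousD (continuousM (fR x) (gI x)) (continuousM (fI x) (gR x)).
by apply/funext => x; rewrite mxE; case: (f x) (g x) => [? ?] [? ?].
Qed.

Lemma scalar_continuous_sum I (r : seq I) (f : I -> T -> F) :
  (forall i, scalar_continuous (f i)) ->
  scalar_continuous (fun x => \sum_(i <- r) f i x).
Proof.
move=> fc; elim: r => [|i r IH].
  by under eq_fun do rewrite big_nil; exact: scalar_continuous_cst.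
by under eq_fun do rewrite big_cons; exact: scalar_continuousD.
Qed.

Lemma scalar_continuous_prod I (r : seq I) (f : I -> T -> F) :
  (forall i, scalar_continuous (f i)) ->
  scalar_continuous (fun x => \prod_(i <- r) f i x).
Proof.
move=> fc; elim: r => [|i r IH].
  by under eq_fun do rewrite big_nil; exact: scalar_continuous_cst.
by under eq_fun do rewrite big_cons; exact: scalar_continuousM.
Qed.

Definition mx_continuous m n (A : T -> 'M[F]_(m, n)) :=
  forall i j, scalar_continuous (fun x => A x i j).

Lemma mx_continuous_cst m n (A : 'M[F]_(m, n)) : mx_continuous (fun=> A).
Proof. by move=> i j; exact: scalar_continuous_cst. Qed.

Lemma mx_continuousD m n (A B : T -> 'M[F]_(m, n)) :
  mx_continuous A -> mx_continuous B -> mx_continuous (fun x => A x + B x).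
Proof.
move=> Ac Bc i j; under eq_fun do rewrite mxE.
exact: scalar_continuousD.
Qed.

Lemma mx_continuousM m n p (A : T -> 'M[F]_(m, n)) (B : T -> 'M[F]_(n, p)) :
  mx_continuous A -> mx_continuous B -> mx_continuous (fun x => A x *m B x).
Proof.
move=> Ac Bc i j; under eq_fun do rewrite mxE.
by apply: scalar_continuous_sum => s; exact: scalar_continuousM.
Qed.

(** By the Leibniz formula the determinant is a sum of signed products of entries. *)
Lemma scalar_continuous_det n (A : T -> 'M[F]_n) :
  mx_continuous A -> scalar_continuous (fun x => \det (A x)).
Proof.
move=> Ac; apply: scalar_continuous_sum => s.
apply: scalar_continuousM; first exact: scalar_continuous_cst.
by apply: scalar_continuous_prod => i; exact: Ac.
Qed.

Lemma open_scalar_neq0 f : scalar_continuous f -> open [set x | f x != 0].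
Proof.
move=> fc.
(* A scalar is nonzero exactly when one of its real coordinates is, so the set is a union of open
   preimages. *)
rewrite (_ : mkset _ = \bigcup_i
    ((fun x => real_coords (f x) i ord0) @^-1` [set y | y != 0])).
  apply: bigcup_open => i _; apply: open_comp; last exact: open_neq.
  by move=> x _; exact: fc.
apply/seteqP; split=> x /=.
  move=> fx; apply: contrapT => N; move/eqP: fx; apply.
  apply: (can_inj real_coordsK); rewrite real_coords0.
  apply/colP => i; rewrite mxE; apply/eqP/negPn/negP => Ni.
  by apply: N; exists i.
by case=> i _ /=; apply: contraNneq => ->; rewrite real_coords0 mxE.
Qed.

End ScalarContinuity.

Lemma mx_continuous_of_real_space n : mx_continuous (@of_real_space n).
Proof.
move=> i j s.
rewrite (_ : (fun x => _) =
    (fun x : 'rV[R]_(a * n ^ 2) => x ord0 (mxvec_index s (mxvec_index i j)))).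
  by move=> x; exact: coord_continuous.
by apply/funext => x; rewrite !mxE of_real_coordsK !mxE.
Qed.

End RealCoordinates.

Theorem lemma5p9 (R : realType) (k : scalars) (n : nat) (hn : (1 <= n)%N)
    (S S' : {vspace 'cV[scalar_field R k]_n}) (hSS' : (S <= S')%VS)
    (p q : nat) (hp : p = \dim S) (hq : q = (\dim S' - \dim S)%N)
    (hqp : (q <= p)%N) :
  embedded_submanifold (alpha k * (n ^ 2 - p * (n - p - q)))%N
    (to_real_space (k := k) (n := n) @` calM S S').
Proof.
(* The inclusion of S in S' gives p + q = dim S', so the codimension over F is (n - dim S') * dim
   S. *)
have -> : (n ^ 2 - p * (n - p - q) = n * n - (n - \dim S') * \dim S)%N.
  by rewrite hp hq -subnDA subnKC ?dimvS // mulnC.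
have [L [Lfree LP]] := mx_preserving_rowspace S S'.
have memL (A : 'M[scalar_field R k]_n) :
    (to_real_space A <= lin1_mx (realify_mul L))%MS <->
    exists Z, A *m basis_mx S = basis_mx S' *m Z.
  by rewrite -LP; exact: submx_realify_mul.
apply: (@embedded_submanifold_rowspace _ _ _ (lin1_mx (realify_mul L))).
- exact: row_free_realify_mul.
- by move=> _ [A /(calM_basis_mxP _ hSS')[AZ _] <-]; apply/memL.
move=> _ [A AM <-].
have [r [C0 [C1 [C2 [detA0 detM]]]]] := calM_locally_linear hSS' AM.
(* This neighbourhood is open among all matrices; within the linear subspace, a nonzero determinant
   forces membership in [calM S S']. *)
exists [set x | \det (C0 + C1 *m of_real_space x *m C2) != 0]; split.
- apply/open_scalar_neq0/scalar_continuous_det/mx_continuousD.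
    exact: mx_continuous_cst.
  apply: mx_continuousM; last exact: mx_continuous_cst.
  apply: mx_continuousM; first exact: mx_continuous_cst.
  exact: mx_continuous_of_real_space.
- by rewrite /= to_real_spaceK.
move=> y /= dety yL; exists (of_real_space y); last exact: of_real_spaceK.
by apply: detM => //; apply/memL; rewrite of_real_spaceK.
Qed.
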